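(* Let $k$ be a field of characteristic zero. Any $n+1$ elements of a free Novikov algebra of rank $n$ over $k$ are Novikov dependent; that is, any $n+1$ elements of the free Novikov algebra $N\langle x_1,\ldots,x_n\rangle$ over $k$ are Novikov dependent.
   Context: A (left) Novikov algebra is a nonassociative algebra $(A,\circ)$ satisfying $(a\circ b)\circ c-a\circ(b\circ c)=(b\circ a)\circ c-b\circ(a\circ c)$ and $(a\circ b)\circ c=(a\circ c)\circ b$ for all $a,b,c\in A$. $k\{x_1,\ldots,x_n\}$ is the differential polynomial algebra over $k$ with one derivation $\delta$: the polynomial algebra over $k$ in independent variables $x_i^{(r)}$ ($1\le i\le n$, $r\ge 0$, $x_i^{(0)}=x_i$), with the $k$-linear derivation given by $\delta(x_i^{(r)})=x_i^{(r+1)}$ (zero on $k$). With the operation $f\circ g=f\,\delta(g)$ it is a Novikov algebra, and $N_0\langle x_1,\ldots,x_n\rangle$ denotes its $\circ$-subalgebra generated by $x_1,\ldots,x_n$. It is the free Novikov algebra without identity in the variables $x_1,\ldots,x_n$, and the differential monomials $x_{i_1}^{(s_1)}\cdots x_{i_t}^{(s_t)}$ with $t-(s_1+\cdots+s_t)=1$ form a basis of it over $k$. The algebra $N\langle x_1,\ldots,x_n\rangle=k\oplus N_0\langle x_1,\ldots,x_n\rangle$, obtained from $N_0\langle x_1,\ldots,x_n\rangle$ by formally adjoining an identity, is called the free Novikov algebra over $k$ in the variables $x_1,\ldots,x_n$ with identity. The rank is the number $n$ of free variables. The algebra $N\langle z_1,\ldots,z_p\rangle$ is defined in the same way in variables $z_1,\ldots,z_p$.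 Elements $f_1,\ldots,f_p$ of $N\langle x_1,\ldots,x_n\rangle$ (in particular, elements of $N_0\langle x_1,\ldots,x_n\rangle$) are called Novikov dependent if there exists a nonzero element $h(z_1,\ldots,z_p)\in N\langle z_1,\ldots,z_p\rangle$ such that $h(f_1,\ldots,f_p)=0$, where $h(f_1,\ldots,f_p)$ is the result of substituting $f_i$ for $z_i$. *)

(* Defs.v *)
From HB Require Import structures.
From mathcomp Require Import all_boot all_order all_algebra.
From mathcomp Require Import finmap.
From mathcomp.multinomials Require Import monalg.

Set Implicit Arguments.
Unset Strict Implicit.
Unset Printing Implicit Defensive.

Import GRing.Theory.
Local Open Scope fset_scope.
Local Open Scope ring_scope.

(* k{x_1, ..., x_n}; the pair (i, r) stands for the variable x_i^(r). *)
Notation jet n := ('I_n * nat)%type.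
Notation dpoly k n := {malg k[{cmonom (jet n)}]}.

Section DifferentialPolynomials.
Variable k : fieldType.
Local Notation dpoly n := (dpoly k n).

Definition dvar n (i : 'I_n) (r : nat) : dpoly n := << ucm (i, r) >>.

(* delta of a monomial m: the sum over the variables v = x_i^(r) of m of
   (exponent of v) * (m / v) * x_i^(r+1). *)
Definition dmon n (m : {cmonom (jet n)}) : dpoly n :=
  \sum_(v <- finsupp m)
     << (m v)%:R *g mmul (divcm m (ucm v)) (ucm (v.1, v.2.+1)) >>.

Definition delta n : dpoly n -> dpoly n :=
  mmap (@mkmalgU {cmonom (jet n)} k mone) (@dmon n).

(* The differential homomorphism over k with x_i |-> g i, that is,
   x_i^(r) |-> delta^r (g i). *)
Definition msubst p n (g : 'I_p -> dpoly n) (m : {cmonom (jet p)}) :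
    dpoly n :=
  \prod_(v <- finsupp m) (iter v.2 (@delta n) (g v.1)) ^+ m v.

Definition dsubst p n (g : 'I_p -> dpoly n) : dpoly p -> dpoly n :=
  mmap (@mkmalgU {cmonom (jet n)} k mone) (msubst g).

Definition circ n (f g : dpoly n) : dpoly n := f * delta g.

Inductive in_N0 n : dpoly n -> Prop :=
  | N0_var i : in_N0 (dvar i 0)
  | N0_zero : in_N0 0
  | N0_add f g : in_N0 f -> in_N0 g -> in_N0 (f + g)
  | N0_scale (c : k) f : in_N0 f -> in_N0 (c *: f)
  | N0_circ f g : in_N0 f -> in_N0 g -> in_N0 (circ f g).

(* k (+) k{x_1, ..., x_n}: the algebra (k{x_1, ..., x_n}, circ) with an
   identity formally adjoined. The adjoined identity (1, 0) is not the
   constant 1 of k{x_1, ..., x_n}, which is not an identity for circ. *)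
Definition hull (n : nat) := (k * dpoly n)%type.

Definition hmul n (u v : hull n) : hull n :=
  (u.1 * v.1, u.1 *: v.2 + v.1 *: u.2 + circ u.2 v.2).

Definition in_N n (u : hull n) : Prop := in_N0 u.2.

Definition Nvar n (i : 'I_n) : hull n := (0, dvar i 0).

(* Expressions in z_1, ..., z_p; EConst c is c times the identity, so that
   EMul (EConst c) e is the scalar multiple c e. *)
Inductive nexpr (p : nat) : Type :=
  | EVar of 'I_p
  | EConst of k
  | EAdd of nexpr p & nexpr p
  | EMul of nexpr p & nexpr p.

Fixpoint neval p n (f : 'I_p -> hull n) (e : nexpr p) : hull n :=
  match e with
  | EVar i => f i
  | EConst c => (c, 0)
  | EAdd a b => neval f a + neval f b
  | EMul a b => hmul (neval f a) (neval f b)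
  end.

(* v is a value of h(f_1, ..., f_p) computed in the algebra N<x_1, ..., x_n>:
   some expression representing h takes the value v at f. By nsubst_N0 below
   this determines v when all f_i lie in N_0<x_1, ..., x_n>. It need not when
   some f_i has a nonzero scalar part: N<x_1, ..., x_n> is not itself a Novikov
   algebra, since (1 o b) o c = (1 o c) o b fails in it, so different
   expressions of h can take different values at f. *)
Definition nsubst p n (h : hull p) (f : 'I_p -> hull n) (v : hull n) : Prop :=
  exists e : nexpr p, neval (@Nvar p) e = h /\ neval f e = v.

(* The inclusion of k (+) N_0<x_1, ..., x_n> in k{x_1, ..., x_n}. *)
Definition dval n (u : hull n) : dpoly n := u.1%:MP + u.2.

(* h(f_1, ..., f_p) = 0. Because of the ambiguity just described, the
   equality is required in both senses that the substitution can be given: in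
   the algebra N<x_1, ..., x_n>, and as a substitution of differential
   polynomials, which is well defined for all f_i. The two conditions are
   equivalent, for h in N<z_1, ..., z_p>, if all f_i lie in
   N_0<x_1, ..., x_n> (vanishes_N0 below). *)
Definition vanishes p n (h : hull p) (f : 'I_p -> hull n) : Prop :=
  nsubst h f 0 /\ dsubst (fun i => dval (f i)) (dval h) = 0.

Definition novikov_dependent p n (f : 'I_p -> hull n) : Prop :=
  exists h : hull p, [/\ in_N h, h != 0 & vanishes h f].

End DifferentialPolynomials.

Lemma malg_ind (K : choiceType) (R : nzRingType) (P : {malg R[K]} -> Prop) :
  P 0 -> (forall c m, P << c *g m >>) ->
  (forall f g, P f -> P g -> P (f + g)) -> forall f, P f.
Proof.
move=> P0 PU PD f; rewrite (monalgE f); elim: (X in \sum_(_ <- X) _) => [|m s IH].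
  by rewrite big_nil.
by rewrite big_cons; apply: PD.
Qed.

Lemma cmonom_ind (I : choiceType) (P : {cmonom I} -> Prop) :
  P mone -> (forall i m, P m -> P (mmul (ucm i) m)) -> forall m, P m.
Proof.
move=> P1 PU m; move: {2}(mdeg m) (leqnn (mdeg m)) => d.
elim: d m => [|d IH] m; first by rewrite leqn0 => /eqP/mdeg_eq0I ->.
have [/eqP|m_neq1] := eqVneq (mdeg m) 0%N; first by move=> /eqP/mdeg_eq0I ->.
have /fset0Pn[i mi] : finsupp m != fset0.
  apply: contra m_neq1 => /eqP m0.
  by rewrite mdegE m0 big_seq_fset0.
have mi_gt0 : (0 < m i)%N by rewrite lt0n cmE_neq0.
have -> : m = mmul (ucm i) (divcm m (ucm i)).
  apply/eqP/cmP => j; rewrite cmM divcmE cmU.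
  by have [<-|_] := eqVneq i j; rewrite ?add0n ?subn0 // subnKC.
by rewrite mdegM mdegU add1n ltnS => /IH; apply: PU.
Qed.

Section Derivations.
Variables (K : conomType) (R : comNzRingType) (D : K -> {malg R[K]}).
Hypothesis DM : forall m1 m2,
  D (mmul m1 m2) = D m1 * << m2 >> + << m1 >> * D m2.
Let d := mmap (@mkmalgU K R mone) D.

Lemma mmap_derivZ c f : d (c *: f) = c *: d f.
Proof.
elim/malg_ind: f => [|b m|f g IHf IHg]; first by rewrite scaler0 /d mmap0 scaler0.
  have -> : c *: << b *g m >> = << c * b *g m >> :> {malg R[K]}.
    by rewrite -mul_malgC malgM_def fgmulUU mul1m.
  by rewrite /d !mmapU 2!mul_malgC scalerA.
by rewrite scalerDr /d !mmapD -/d IHf IHg scalerDr.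
Qed.

Lemma mmap_derivM f g : d (f * g) = d f * g + f * d g.
Proof.
elim/malg_ind: f => [|a m1|f1 f2 IH1 IH2]; last first.
- by rewrite mulrDl /d !mmapD -/d IH1 IH2 !mulrDl addrACA.
- have toZ c m : << c *g m >> = c *: << m >> :> {malg R[K]}.
    by rewrite -mul_malgC malgM_def fgmulUU mul1m mulr1.
  elim/malg_ind: g => [|b m2|g1 g2 IH1 IH2]; last first.
  + by rewrite mulrDr /d !mmapD -/d IH1 IH2 !mulrDr addrACA.
  + have dU m : d << m >> = D m by rewrite /d mmapU mul_malgC scale1r.
    have UM m m' : << m >> * << m' >> = << mmul m m' >> :> {malg R[K]}.
      by rewrite malgM_def fgmulUU mulr1.
    rewrite (toZ a) (toZ b) -scalerAl -scalerAr UM !mmap_derivZ !dU DM.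
    by rewrite -!scalerAl -!scalerAr !scalerDr.
  + by rewrite /d mmap0 !mulr0 mmap0 addr0.
- by rewrite /d mmap0 !mul0r mmap0 addr0.
Qed.
End Derivations.

Section LeibnizMaps.
Variables (A B : comNzRingType) (dA : A -> A) (dB : B -> B).
Hypothesis dAM : forall f g, dA (f * g) = dA f * g + f * dA g.
Hypothesis dBM : forall f g, dB (f * g) = dB f * g + f * dB g.

Lemma leibniz_left_symmetric (f g h : A) :
  (f * dA g) * dA h - f * dA (g * dA h) =
  (g * dA f) * dA h - g * dA (f * dA h).
Proof.
by rewrite !dAM !mulrDr !mulrA !opprD !addrA !subrr !sub0r (mulrC f).
Qed.

Lemma leibniz_right_commutative (f g h : A) :
  (f * dA g) * dA h = (f * dA h) * dA g.
Proof. exact: mulrAC. Qed.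

Lemma leibniz_commutesM (phi : {rmorphism A -> B}) f g :
  phi (dA f) = dB (phi f) -> phi (dA g) = dB (phi g) ->
  phi (dA (f * g)) = dB (phi (f * g)).
Proof. by move=> Hf Hg; rewrite dAM rmorphD !rmorphM /= dBM Hf Hg. Qed.
End LeibnizMaps.

Section Theory.
Variables (k : fieldType) (n : nat).
Local Notation dpoly n := (dpoly k n).
Implicit Types (f g h : dpoly n) (m : {cmonom (jet n)}).

Lemma dmonE m (d : {fset (jet n)}) : finsupp m `<=` d ->
  dmon k m = \sum_(v <- d)
     << (m v)%:R *g mmul (divcm m (ucm v)) (ucm (v.1, v.2.+1)) >>.
Proof.
move=> le; rewrite /dmon (big_fset_incl _ le) // => v _.
by rewrite -cmE_eq0 => /eqP ->; rewrite monalgU0.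
Qed.

Lemma dmonM m1 m2 :
  dmon k (mmul m1 m2) = dmon k m1 * << m2 >> + << m1 >> * dmon k m2.
Proof.
pose d := finsupp m1 `|` finsupp m2.
rewrite (dmonE (d := d)) ?mdomD //.
rewrite (dmonE (m := m1) (d := d)) ?fsubsetUl //.
rewrite (dmonE (m := m2) (d := d)) ?fsubsetUr //.
rewrite mulr_suml [X in _ = _ + X]mulr_sumr -big_split.
apply: eq_bigr => v _ /=.
have aux m m' w : << (m v)%:R *g mmul (divcm (mmul m m') (ucm v)) w >> =
    << (m v)%:R *g mmul m' (mmul (divcm m (ucm v)) w) >> :> dpoly n.
  case: (posnP (m v)) => [->|m_gt0]; first by rewrite !monalgU0.
  apply: (congr1 (fun w => << _ *g w >>)).
  apply/eqP/cmP => x; rewrite !cmM !divcmE cmM cmU.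
  have [<-|_] := eqVneq v x; last by rewrite !subn0 addnCA addnA.
  by rewrite addnA; congr (_ + _)%N; rewrite addnC -addnBA.
have UM (a b : k) (u w : {cmonom (jet n)}) :
    (<< a *g u >> : dpoly n) * << b *g w >> = << a * b *g mmul u w >>.
  exact: fgmulUU.
rewrite [X in _ = X + _]UM [X in _ = _ + X]UM mulr1 mul1r cmM natrD monalgUD.
rewrite aux (mulmC m1 m2) aux.
by rewrite [X in (<< _ *g X >> + _ = _)]mulmC.
Qed.

Lemma deltaD f g : delta (f + g) = delta f + delta g.
Proof. exact: mmapD. Qed.

Lemma deltaZ (c : k) f : delta (c *: f) = c *: delta f.
Proof. exact: mmap_derivZ. Qed.

Lemma deltaM f g : delta (f * g) = delta f * g + f * delta g.
Proof. exact: (mmap_derivM dmonM). Qed.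

Lemma deltaU m : delta (<< m >> : dpoly n) = dmon k m.
Proof. by rewrite /delta mmapU mul_malgC scale1r. Qed.

Lemma delta_dvar i r : delta (dvar k i r : dpoly n) = dvar k i r.+1.
Proof.
rewrite deltaU /dmon mdomU big_seq_fset1 cmUU /dvar /=.
apply: (congr1 (fun w => << _ *g w >>)); rewrite -[RHS]mul1m.
apply: (congr1 (fun w => mmul w _)).
by apply/eqP/cmP => x; rewrite divcmE subnn cm1.
Qed.

Lemma delta1 : delta (1 : dpoly n) = 0.
Proof. by rewrite deltaU /dmon mdom1 big_seq_fset0. Qed.

Lemma circ_left_symmetric f g h :
  circ (circ f g) h - circ f (circ g h) = circ (circ g f) h - circ g (circ f h).
Proof. exact: (leibniz_left_symmetric deltaM). Qed.

Lemma circ_right_commutative f g h : circ (circ f g) h = circ (circ f h) g.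
Proof. exact: (leibniz_right_commutative (@delta k n)). Qed.

End Theory.

Section Substitution.
Variables (k : fieldType) (p n : nat) (g : 'I_p -> dpoly k n).

Lemma msubstE (m : {cmonom (jet p)}) (d : {fset (jet p)}) : finsupp m `<=` d ->
  msubst g m = \prod_(v <- d) (iter v.2 (@delta k n) (g v.1)) ^+ m v.
Proof.
move=> le; rewrite /msubst (big_fset_incl _ le) // => v _.
by rewrite -cmE_eq0 => /eqP ->; rewrite expr0.
Qed.

Lemma msubst_is_multiplicative : mmorphism (msubst g).
Proof.
split=> [m1 m2|]; last by rewrite /msubst mdom1 big_seq_fset0.
pose d := finsupp m1 `|` finsupp m2.
rewrite (msubstE (d := d)) ?mdomD //.
rewrite (msubstE (m := m1) (d := d)) ?fsubsetUl //.
rewrite (msubstE (m := m2) (d := d)) ?fsubsetUr //.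
by rewrite -big_split; apply: eq_bigr => v _ /=; rewrite cmM exprD.
Qed.

HB.instance Definition _ :=
  isMultiplicative.Build _ _ (msubst g) msubst_is_multiplicative.

HB.instance Definition _ := GRing.RMorphism.on (dsubst g).

Lemma dsubstD f1 f2 : dsubst g (f1 + f2) = dsubst g f1 + dsubst g f2.
Proof. exact: mmapD. Qed.

Lemma dsubstM f1 f2 : dsubst g (f1 * f2) = dsubst g f1 * dsubst g f2.
Proof. exact: (rmorphM (dsubst g)). Qed.

Lemma dsubstC (c : k) : dsubst g c%:MP = c%:MP.
Proof. exact: mmapC. Qed.

Lemma dsubstZ (c : k) f : dsubst g (c *: f) = c *: dsubst g f.
Proof. by rewrite -!mul_malgC dsubstM dsubstC. Qed.

Lemma dsubst_dvar i r : dsubst g (dvar k i r) = iter r (@delta k n) (g i).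
Proof.
rewrite /dsubst mmapU mul_malgC scale1r /msubst mdomU big_seq_fset1 cmUU.
exact: expr1.
Qed.

Lemma dsubst_delta f : dsubst g (delta f) = delta (dsubst g f).
Proof.
pose P (q : dpoly k p) := dsubst g (delta q) = delta (dsubst g q).
have PM q1 q2 : P q1 -> P q2 -> P (q1 * q2).
  exact: (leibniz_commutesM (@deltaM k p) (@deltaM k n) (phi := dsubst g)).
have PZ c q : P q -> P (c *: q).
  by move=> Pq; rewrite /P deltaZ [LHS]dsubstZ [in RHS]dsubstZ [RHS]deltaZ -Pq.
have PU m : P << m >>.
  elim/cmonom_ind: m => [|[i r] m Pm].
    rewrite /P deltaU /dmon mdom1 big_seq_fset0 /dsubst mmap0.
    have -> : mmap (@mkmalgU _ k mone) (msubst g) << mone >> = 1 by exact: mmap1.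
    by rewrite delta1.
  have -> : << mmul (ucm (i, r)) m >> = dvar k i r * << m >>.
    by rewrite -[X in << X *g _ >>](mulr1 1); symmetry; exact: fgmulUU.
  apply: (PM _ _ _ Pm).
  rewrite /P delta_dvar.
  rewrite [LHS]dsubst_dvar.
  rewrite iterS.
  congr (delta _).
  symmetry; exact: dsubst_dvar.
elim/malg_ind: f => [|c m|f1 f2 P1 P2].
- by rewrite /delta /dsubst !mmap0.
- have -> : << c *g m >> = c *: << m >> :> dpoly k p.
    by rewrite -mul_malgC malgM_def fgmulUU mul1m mulr1.
  exact/PZ/PU.
- rewrite deltaD [LHS]dsubstD [in RHS]dsubstD [RHS]deltaD.
  exact: (congr2 +%R P1 P2).
Qed.

End Substitution.

Lemma eq_dsubst (k : fieldType) p n (g1 g2 : 'I_p -> dpoly k n) :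
  g1 =1 g2 -> dsubst g1 =1 dsubst g2.
Proof.
move=> E f; rewrite /dsubst /mmap; apply: eq_bigr => m _.
apply: (congr1 ( *%R _)); rewrite /msubst.
by apply: eq_bigr => v _; rewrite E.
Qed.

Section SubstitutionInN0.
Variables (k : fieldType) (p n : nat) (f : 'I_p -> hull k n).
Hypothesis f_N0 : forall i, (f i).1 = 0.

Lemma neval_N0 e : neval f e =
  ((neval (@Nvar k p) e).1, dsubst (fun i => (f i).2) (neval (@Nvar k p) e).2).
Proof.
elim: e => [i|c|a IHa b IHb|a IHa b IHb] /=.
- by rewrite dsubst_dvar -(f_N0 i); case: (f i).
- by rewrite /dsubst mmap0.
- by rewrite IHa IHb dsubstD.
- rewrite IHa IHb /hmul /=; apply: (congr1 (pair _)).
  rewrite [RHS]dsubstD [X in _ = X + _]dsubstD [X in _ = X + _ + _]dsubstZ.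
  rewrite [X in _ = _ + X + _]dsubstZ [X in _ = _ + X]dsubstM.
  rewrite [X in _ = _ + _ * X]dsubst_delta.
  reflexivity.
Qed.

Lemma in_N_neval (h : hull k p) :
  in_N h -> exists e, neval (@Nvar k p) e = h.
Proof.
have main q : in_N0 q -> exists e, neval (@Nvar k p) e = (0, q).
  elim=> {q} [i||q1 q2 _ [e1 E1] _ [e2 E2]|c q _ [e E]|q1 q2 _ [e1 E1] _ [e2 E2]].
  - by exists (EVar k i).
  - by exists (EConst p 0).
  - exists (EAdd e1 e2); rewrite /= E1 E2.
    by rewrite [LHS]surjective_pairing /= addr0.
  - exists (EMul (EConst p c) e); rewrite /= E /hmul /=.
    by rewrite mulr0 scale0r /circ mul0r !addr0.
  - exists (EMul e1 e2); rewrite /= E1 E2 /hmul /=.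
    by rewrite mulr0 !scale0r !add0r.
case: h => c q /main[e E]; exists (EAdd (EConst p c) e).
by rewrite /= E [LHS]surjective_pairing /= addr0 add0r.
Qed.

Lemma nsubst_N0 (h : hull k p) (v : hull k n) : in_N h ->
  nsubst h f v <-> v = (h.1, dsubst (fun i => (f i).2) h.2).
Proof.
move=> /in_N_neval[e E]; split=> [[e' [E' <-]]|->].
  by rewrite neval_N0 E'.
by exists e; rewrite neval_N0 E.
Qed.

Lemma mcoeff1_N0 m (q : dpoly k m) : in_N0 q -> q@_mone = 0.
Proof.
elim=> {q} [i||q1 q2 _ E1 _ E2|c q _ E|q1 q2 _ E1 _ _].
- by rewrite mcoeffU1 cm1_eq1.
- exact: mcoeff0.
- by rewrite mcoeffD E1 E2 addr0.
- by rewrite mcoeffZ E mulr0.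
- by rewrite /circ (mcoeff1g_is_multiplicative _ _).1 E1 mul0r.
Qed.

Lemma vanishes_N0 (h : hull k p) : in_N h -> (forall i, in_N (f i)) ->
  nsubst h f 0 <-> dsubst (fun i => dval (f i)) (dval h) = 0.
Proof.
move=> hN fN; rewrite nsubst_N0 //.
set q := dsubst _ h.2.
have q1 : q@_mone = 0.
  rewrite /q; elim: hN => [i||q1 q2 _ E1 _ E2|c q' _ E|q1 q2 _ E1 _ _].
  - by rewrite dsubst_dvar; apply: mcoeff1_N0 (fN i).
  - by rewrite /dsubst mmap0 mcoeff0.
  - rewrite dsubstD mcoeffD -[RHS](addr0 0).
    exact: (congr2 +%R E1 E2).
  - by rewrite dsubstZ mcoeffZ E mulr0.
  - rewrite /circ dsubstM -[RHS](mul0r (dsubst (fun i => (f i).2) (delta q2))@_mone).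
    rewrite -[in RHS]E1; exact: (mcoeff1g_is_multiplicative _ _).1.
have -> : dsubst (fun i => dval (f i)) (dval h) = h.1%:MP + q.
  rewrite dsubstD dsubstC; apply: (congr1 (fun r => _ + r)).
  apply: eq_dsubst => i.
  by rewrite /dval f_N0 malgC0E add0r.
split=> [[<- <-]|E]; first by rewrite malgC0E addr0.
have h1 : h.1 = 0.
  have := congr1 (mcoeff mone) E.
  by rewrite mcoeffD q1 addr0 mcoeff0 malgCK.
by move: E; rewrite h1 malgC0E add0r => ->.
Qed.

End SubstitutionInN0.

(* Main.v *)
Require Import Defs.
From HB Require Import structures.
From mathcomp Require Import all_boot all_algebra.
From mathcomp Require Import finmap zify.
From mathcomp.multinomials Require Import monalg.
Import GRing.Theory.
Local Open Scope ring_scope.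

(** The proof compares growth rates, as in the classical argument that n + 1
    differential polynomials in n variables are differentially dependent, but
    it is run on a family of expressions in the Novikov operation itself.

    Fix z = z_0.  Left multiplication by z gives u_(i,r) = z o (z o ... o z_i)
    with r factors z, that is (z delta)^r z_i.  Right multiplication by u
    multiplies by delta u, and such multiplications commute; so starting from
    z and multiplying on the right by each u_(i,r), r < R, with multiplicity
    t_(i,r) at most d, one reaches
         z * prod_(i,r) (delta u_(i,r)) ^ t_(i,r).
    There are (d + 1)^((n+1) R) such products.  They are linearly independent
    in k{z_0, ..., z_n} (rmul_independent): delta u_(i,r) is
    z^r * z_i^(r+1) plus terms of order at most r, and this triangular shape
    allows a ring homomorphism (not a differential one) sending z to 1 and
    delta u_(i,r) to independent variables (lmul_iter_independent).

    Evaluated at f_0, ..., f_n, each left multiplication by z raises the order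
    by at most one.  The values therefore have order at most S + R and degree
    at most (d + 1) times a constant, where S depends only on f
    (bounded_rmul_expr).  They lie in a space whose dimension is at most
    (d + 1)^(n (S + R + 1)) times a constant independent of d.  If R exceeds
    n (S + 1), then (n+1) R exceeds n (S + R + 1), and for large d there are
    more products than dimensions (counting): some nontrivial linear
    combination of the products vanishes at f.

    The two meanings of substitution, in the algebra with adjoined identity
    and as differential polynomials, may differ when the f_i have scalar
    parts.  Both are linear in the expression and satisfy the same bounds, so
    the relation is sought in the direct sum of the two target spaces, which
    only doubles the dimension. *)

Set Implicit Arguments.
Unset Strict Implicit.
Unset Printing Implicit Defensive.

(** * Differential polynomials of bounded order and degree *)

Section BoundedPolynomials.
Variables (k : fieldType) (n : nat).
Implicit Types (f g : dpoly k n) (m : {cmonom (jet n)}).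

(** A variant rather than a plain definition, so that the monomial does not
    become an argument of the lemmas below. *)
Variant bounded s d f : Prop :=
  Bounded of forall m, m \in msupp f ->
    (mdeg m <= d)%N /\ forall v, (s < v.2)%N -> m v = 0%N.

Lemma boundedW s1 s2 d1 d2 f : (s1 <= s2)%N -> (d1 <= d2)%N ->
  bounded s1 d1 f -> bounded s2 d2 f.
Proof.
move=> ss dd [bf]; split=> m /bf[md mv]; split; first exact: leq_trans dd.
by move=> v sv; apply: mv; apply: leq_ltn_trans sv.
Qed.

Lemma bounded0 s d : bounded s d 0.
Proof. by split=> m; rewrite msupp0 inE. Qed.

Lemma boundedU s d (c : k) m : (mdeg m <= d)%N ->
  (forall v, (s < v.2)%N -> m v = 0%N) -> bounded s d << c *g m >>.
Proof. by move=> md mv; split=> m' /(fsubsetP msuppU_le)/fset1P ->. Qed.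

Lemma boundedC s d (c : k) : bounded s d c%:MP.
Proof. by apply: boundedU => [|v _]; rewrite ?mdeg1 ?cm1. Qed.

Lemma boundedD s d f g : bounded s d f -> bounded s d g -> bounded s d (f + g).
Proof.
move=> [bf] [bg]; split=> m /(fsubsetP (msuppD_le f g)).
by rewrite inE => /orP[/bf|/bg].
Qed.

Lemma bounded_sum s d (T : eqType) (r : seq T) (F : T -> dpoly k n) :
  (forall i, i \in r -> bounded s d (F i)) -> bounded s d (\sum_(i <- r) F i).
Proof.
elim: r => [|i r IHr] bF; first by rewrite big_nil; apply: bounded0.
rewrite big_cons; apply: boundedD; first by apply: bF; rewrite mem_head.
by apply: IHr => j jr; apply: bF; rewrite in_cons jr orbT.
Qed.

Lemma boundedM s d1 d2 f g :
  bounded s d1 f -> bounded s d2 g -> bounded s (d1 + d2) (f * g).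
Proof.
move=> [bf] [bg]; split=> m /msuppM_le[m1 [m2 []]].
move=> /bf[d1m v1] /bg[d2m v2] ->; split.
  by rewrite mdegM leq_add.
by move=> v sv; rewrite cmM v1 ?v2.
Qed.

Lemma boundedZ s d (c : k) f : bounded s d f -> bounded s d (c *: f).
Proof. by move=> [bf]; split=> m /(fsubsetP (msuppZ_le c f))/bf. Qed.

Lemma bounded_dvar i r : bounded r 1 (dvar k i r : dpoly k n).
Proof.
apply: boundedU; first by rewrite mdegU.
by move=> v rv; rewrite cmU; case: eqP rv => [<-|] //=; rewrite ltnn.
Qed.

Lemma bounded_delta s d f : bounded s d f -> bounded s.+1 d (delta f).
Proof.
move=> [bf]; rewrite /delta mmapE; apply: bounded_sum => m /bf[md mv].
rewrite mul_malgC; apply: boundedZ; apply: bounded_sum => v vm.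
have mvE : (0 < m v)%N by rewrite lt0n cmE_neq0.
apply: boundedU => [|w sw].
  rewrite mdegM mdegU addn1; apply: leq_trans md.
  (* Replacing one factor v of m by its derivative keeps the degree. *)
  have {2}-> : m = mmul (ucm v) (divcm m (ucm v)).
    apply/eqP/cmP => j; rewrite cmM divcmE cmU.
    by have [<-|_] := eqVneq v j; rewrite ?add0n ?subn0 // subnKC.
  by rewrite mdegM mdegU.
rewrite cmM divcmE mv ?(ltn_trans _ sw) // sub0n add0n cmU.
case: eqP sw => //= <- /=; rewrite ltnS => sv.
by rewrite mv in mvE.
Qed.

Lemma bounded_ex f : exists s d, bounded s d f.
Proof.
elim/malg_ind: f => [|c m|f g [s1 [d1 b1]] [s2 [d2 b2]]].
- by exists 0%N, 0%N; apply: bounded0.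
- exists (\max_(v <- finsupp m) v.2)%N, (mdeg m); apply: boundedU => // v.
  move=> vm; apply/eqP; rewrite cmE_eq0; apply: contraTN vm => vm.
  by rewrite -leqNgt (big_rem v) //= leq_maxl.
- exists (maxn s1 s2), (maxn d1 d2); apply: boundedD.
  + by apply: boundedW b1; rewrite leq_maxl.
  + by apply: boundedW b2; rewrite leq_maxr.
Qed.

Lemma bounded_family_ex (I : finType) (F : I -> dpoly k n) :
  exists s d, forall i, bounded s d (F i).
Proof.
have [s [d bF]] : exists s d, forall i, i \in enum I -> bounded s d (F i).
  elim: (enum I) => [|i r [s [d IHr]]]; first by exists 0%N, 0%N.
  have [s' [d' b']] := bounded_ex (F i).
  exists (maxn s s'), (maxn d d') => j; rewrite in_cons => /predU1P[->|/IHr].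
    by apply: boundedW b'; rewrite leq_maxr.
  by apply: boundedW; rewrite leq_maxl.
by exists s, d => i; apply: bF; rewrite mem_enum.
Qed.

End BoundedPolynomials.

(** * Monomials with prescribed exponents, and linear relations *)

Section JetMonomials.
Variables (k : fieldType) (n s d : nat).
Implicit Types t : {ffun 'I_n * 'I_s -> 'I_d.+1}.

Definition jet_mon t : {cmonom (jet n)} :=
  \big[mmul/mone]_v iter (t v) (mmul (ucm (v.1, nat_of_ord v.2))) mone.

Lemma jet_monE t w :
  jet_mon t w = (\sum_v t v * ((v.1, nat_of_ord v.2) == w))%N.
Proof.
rewrite /jet_mon (big_morph (fun m : {cmonom (jet n)} => m w) (cmM w) (cm1 w)).
apply: eq_bigr => v _; elim: (nat_of_ord (t v)) => [|j IHj] /=.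
  by rewrite cm1.
by rewrite cmM cmU IHj mulSn.
Qed.

Lemma jet_mon_in t i (r : 'I_s) : jet_mon t (i, nat_of_ord r) = t (i, r).
Proof.
rewrite jet_monE (bigD1 (i, r)) //= eqxx muln1 big1 ?addn0 // => -[j q] /=.
rewrite !xpair_eqE => /negbTE jq.
by rewrite -[(nat_of_ord q == r)]/(q == r) jq muln0.
Qed.

Lemma jet_mon_inj : injective jet_mon.
Proof.
move=> t1 t2 E; apply/ffunP => -[i r]; apply: val_inj.
by rewrite /= -!jet_mon_in E.
Qed.

Lemma jet_mon_out t w : (s <= w.2)%N -> jet_mon t w = 0%N.
Proof.
move=> sw; rewrite jet_monE big1 // => v _.
by case: eqP sw => [<-|]; rewrite ?muln0 //= leqNgt ltn_ord.
Qed.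

Lemma jet_mon_prod t :
  << jet_mon t >> = \prod_(v : 'I_n * 'I_s) dvar k v.1 v.2 ^+ t v :> dpoly k n.
Proof.
have UM (m1 m2 : {cmonom (jet n)}) :
    << mmul m1 m2 >> = << m1 >> * << m2 >> :> dpoly k n.
  by rewrite malgM_def fgmulUU mulr1.
rewrite /jet_mon (big_morph (fun m => << m >> : dpoly k n) UM erefl).
apply: eq_bigr => v _; elim: (nat_of_ord (t v)) => [|j IHj] //=.
by rewrite UM IHj exprS.
Qed.
End JetMonomials.

(** The monomials of order at most s and degree at most d are among the
    finitely many whose exponents are at most d; allowing these is enough for
    the count and avoids binomial coefficients. *)
Lemma bounded_eq0 (k : fieldType) n s d (f : dpoly k n) : bounded s d f ->
  (forall t : {ffun 'I_n * 'I_s.+1 -> 'I_d.+1}, f@_(jet_mon t) = 0) -> f = 0.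
Proof.
move=> [bf] f0; apply/malgP => m; rewrite mcoeff0.
case: msuppP => // /bf[md mv].
pose t := [ffun v : 'I_n * 'I_s.+1 => inord (m (v.1, nat_of_ord v.2))] :
  {ffun 'I_n * 'I_s.+1 -> 'I_d.+1}.
have le_deg v : (m v <= mdeg m)%N.
  have [vm|vm] := boolP (v \in finsupp m).
    by rewrite mdegE (big_rem v) //= leq_addr.
  by move: vm; rewrite -cmE_eq0 => /eqP ->.
have mE : m = jet_mon t; last by rewrite mE f0.
apply/eqP/cmP => -[i r]; have [rs|sr] := ltnP r s.+1.
  rewrite -[r]/(nat_of_ord (Ordinal rs)) jet_mon_in ffunE inordK //.
  by rewrite ltnS (leq_trans _ md).
by rewrite jet_mon_out // mv.
Qed.

Lemma linear_relation (k : fieldType) (I J : finType) (M : I -> J -> k) :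
  (#|J| < #|I|)%N ->
  exists2 c : I -> k, (exists i, c i != 0) & forall j, \sum_i c i * M i j = 0.
Proof.
move=> JI; pose A := \matrix_(i < #|I|, j < #|J|) M (enum_val i) (enum_val j).
have /rowV0Pn[u /sub_kermxP uA u0] : kermx A != 0.
  by rewrite kermx_eq0 /row_free neq_ltn (leq_ltn_trans (rank_leq_col A)).
exists (fun i => u 0 (enum_rank i)).
  have [i ui] := rV0Pn _ u0; exists (enum_val i).
  by rewrite enum_valK.
move=> j.
have uAj : \sum_l u 0 l * A l (enum_rank j) = 0.
  by have := congr1 (fun B : 'rV_ _ => B 0 (enum_rank j)) uA; rewrite !mxE.
rewrite -[RHS]uAj [RHS](reindex _ (onW_bij _ (enum_rank_bij I))) /=.
by apply: eq_bigr => i _; rewrite mxE !enum_rankK.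
Qed.

(** * Evaluation homomorphisms *)

Section Evaluation.
Variables (k : fieldType) (n p : nat) (x : jet n -> dpoly k p).

(** Unlike dsubst, the evaluation treats all the variables x_i^(r) as
    independent: x need not be compatible with delta. *)
Definition jet_meval (m : {cmonom (jet n)}) : dpoly k p :=
  \prod_(v <- finsupp m) x v ^+ m v.

Lemma jet_mevalE (m : {cmonom (jet n)}) (D : {fset (jet n)}) :
  (finsupp m `<=` D)%fset -> jet_meval m = \prod_(v <- D) x v ^+ m v.
Proof.
move=> le; rewrite /jet_meval (big_fset_incl _ le) // => v _.
by rewrite -cmE_eq0 => /eqP ->; rewrite expr0.
Qed.

Lemma jet_meval_is_multiplicative : mmorphism jet_meval.
Proof.
split=> [m1 m2|]; last by rewrite /jet_meval mdom1 big_seq_fset0.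
pose D := (finsupp m1 `|` finsupp m2)%fset.
rewrite (jet_mevalE (D := D)) ?mdomD //.
rewrite (jet_mevalE (m := m1) (D := D)) ?fsubsetUl //.
rewrite (jet_mevalE (m := m2) (D := D)) ?fsubsetUr //.
by rewrite -big_split; apply: eq_bigr => v _ /=; rewrite cmM exprD.
Qed.

HB.instance Definition _ :=
  isMultiplicative.Build _ _ jet_meval jet_meval_is_multiplicative.

Definition jet_eval : dpoly k n -> dpoly k p :=
  mmap (@mkmalgU {cmonom (jet p)} k mone) jet_meval.

HB.instance Definition _ := GRing.RMorphism.on jet_eval.

Lemma jet_eval1 : jet_eval 1 = 1.
Proof. exact: mmap1. Qed.

Lemma jet_evalD f g : jet_eval (f + g) = jet_eval f + jet_eval g.
Proof. exact: mmapD. Qed.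

Lemma jet_evalM f g : jet_eval (f * g) = jet_eval f * jet_eval g.
Proof. exact: (rmorphM jet_eval). Qed.

Lemma jet_evalZ (c : k) f : jet_eval (c *: f) = c *: jet_eval f.
Proof.
rewrite -!mul_malgC jet_evalM; apply: (congr1 ( *%R^~ _)).
exact: mmapC.
Qed.

Lemma jet_eval_dvar i r : jet_eval (dvar k i r) = x (i, r).
Proof.
rewrite /jet_eval mmapU mul_malgC scale1r /jet_meval mdomU big_seq_fset1 cmUU.
exact: expr1.
Qed.
End Evaluation.

Lemma eq_jet_eval (k : fieldType) n p s d (x y : jet n -> dpoly k p)
    (f : dpoly k n) :
  bounded s d f -> (forall v, (v.2 <= s)%N -> x v = y v) ->
  jet_eval x f = jet_eval y f.
Proof.
move=> [bf] xy; rewrite /jet_eval /mmap; apply: eq_big_seq => m /bf[_ mv].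
apply: (congr1 ( *%R _)); rewrite /jet_meval; apply: eq_big_seq => v.
rewrite -cmE_neq0 => mv0; rewrite xy // leqNgt.
by apply: contraNN mv0 => /mv ->.
Qed.

(** * Iterated left multiplication *)

(** The algebra of the next proofs, over abstract rings.  This is the passage
    from delta ((z delta)^r z_i) to delta ((z delta)^(r+1) z_i), with
    a = z, b = z_i^(r+1), b' = z_i^(r+2) and c = delta ((z delta)^r z_i). *)
Lemma leibniz_leading (A : comNzRingType) (D : A -> A) (a b b' c : A) r :
  (forall f g, D (f + g) = D f + D g) ->
  (forall f g, D (f * g) = D f * g + f * D g) -> D b = b' ->
  D (a * c) - a ^+ r.+1 * b' =
  D (a ^+ r.+1) * b + D (a * (c - a ^+ r * b)).
Proof.
move=> DD DM <-; have -> : a * c = a ^+ r.+1 * b + a * (c - a ^+ r * b).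
  by rewrite mulrBr mulrA -exprS addrC subrK.
by rewrite DD DM addrAC addrK.
Qed.

Lemma solve_leading (A : comNzRingType) (a b : A) r : a + 1 ^+ r * (b - a) = b.
Proof. by rewrite expr1n mul1r addrC subrK. Qed.

Lemma morph_split (A B : comNzRingType) (h : A -> B) (a b c : A) r :
  h 1 = 1 -> (forall f g, h (f + g) = h f + h g) ->
  (forall f g, h (f * g) = h f * h g) ->
  h c = h (c - a ^+ r * b) + h a ^+ r * h b.
Proof.
move=> h1 hD hM; have hX : h (a ^+ r) = h a ^+ r.
  by elim: r => [|r IHr]; rewrite ?expr0 // !exprS hM IHr.
by rewrite -hX -hM -hD subrK.
Qed.

Section IteratedLeftMultiplication.
Variables (k : fieldType) (n : nat) (z : 'I_n).

Definition lmul_iter (i : 'I_n) r : dpoly k n :=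
  iter r (circ (dvar k z 0)) (dvar k i 0).

(** The leading term of delta u is z^r * z_i^(r+1): in the induction step, the
    only term of higher order arises by differentiating z_i^(r+1). *)
Lemma delta_lmul_iter i r :
  bounded r r.+1
    (delta (lmul_iter i r) - dvar k z 0 ^+ r * dvar k i r.+1).
Proof.
elim: r => [|r IHr].
  by rewrite /lmul_iter /= delta_dvar expr0 mul1r subrr; apply: bounded0.
have bX : bounded 0 r.+1 (dvar k z 0 ^+ r.+1).
  elim: r.+1 => [|j IHj]; first by rewrite expr0; apply: boundedC.
  by rewrite exprS -[j.+1]/(1 + j)%N; apply/boundedM/IHj/bounded_dvar.
have E : delta (lmul_iter i r.+1) - dvar k z 0 ^+ r.+1 * dvar k i r.+2 = _ :=
  leibniz_leading (dvar k z 0) (delta (lmul_iter i r)) r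
    (@deltaD k n) (@deltaM k n) (delta_dvar k i r.+1).
rewrite E; apply: boundedD.
  rewrite -(addn1 r.+1); apply: boundedM; last exact: bounded_dvar.
  by apply: (boundedW _ _ (bounded_delta bX)).
apply: bounded_delta; rewrite -[r.+2]/(1 + r.+1)%N; apply: boundedM => //.
exact: (boundedW (leq0n r) (leqnn 1) (bounded_dvar k z 0)).
Qed.

(** The elements delta u_(i,r) are algebraically independent, in the strong
    form that independent variables can be imposed as their values by a choice
    of values for the z_i^(j).  These are chosen by recursion on the order:
    once those of order at most R are fixed and z is sent to 1, the equation
    for delta u_(i,R) determines the value of z_i^(R+1), since all the other
    terms of delta u_(i,R) have order at most R. *)
Lemma lmul_iter_independent (R : nat) : exists2 x : jet n -> dpoly k n,
  x (z, 0%N) = 1 &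
  forall i r, (r < R)%N -> jet_eval x (delta (lmul_iter i r)) = dvar k i r.
Proof.
elim: R => [|R [x x1 xR]]; first by exists (fun=> 1).
pose E i : dpoly k n := delta (lmul_iter i R) - dvar k z 0 ^+ R * dvar k i R.+1.
pose y v : dpoly k n :=
  if (v.2 <= R)%N then x v else dvar k v.1 R - jet_eval x (E v.1).
have xy v : (v.2 <= R)%N -> y v = x v by rewrite /y => ->.
have bE i r : (r <= R)%N ->
    jet_eval y (delta (lmul_iter i r) - dvar k z 0 ^+ r * dvar k i r.+1) =
    jet_eval x (delta (lmul_iter i r) - dvar k z 0 ^+ r * dvar k i r.+1).
  move=> rR; apply: (eq_jet_eval (delta_lmul_iter _ _)) => v vr.
  by rewrite xy // (leq_trans vr).
have splitE (u : jet n -> dpoly k n) i r : jet_eval u (delta (lmul_iter i r)) =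
    jet_eval u (delta (lmul_iter i r) - dvar k z 0 ^+ r * dvar k i r.+1)
    + u (z, 0%N) ^+ r * u (i, r.+1).
  rewrite -(jet_eval_dvar u z) -(jet_eval_dvar u i).
  exact: (morph_split (dvar k z 0) (dvar k i r.+1) (delta (lmul_iter i r)) r
    (jet_eval1 u) (jet_evalD u) (jet_evalM u)).
have y1 : y (z, 0%N) = 1 := etrans (xy (z, 0%N) (leq0n R)) x1.
exists y; first exact: y1.
move=> i r; rewrite ltnS leq_eqVlt => /predU1P[->|rR].
  have yR : y (i, R.+1) = dvar k i R - jet_eval x (E i) by rewrite /y /= ltnn.
  apply: (etrans (splitE y i R)); rewrite (bE i R (leqnn R)) y1 yR.
  exact: solve_leading.
rewrite -(xR i r rR); apply: (etrans (splitE y i r)).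
by rewrite (bE i r (ltnW rR)) y1 (xy (i, r.+1) rR) [RHS]splitE x1.
Qed.
End IteratedLeftMultiplication.

(** * Expressions and the growth of their values *)

Section BoundedExpressions.
Variables (k : fieldType) (p n : nat) (f : 'I_p -> hull k n).
Local Notation F := (fun i => dval (f i)).

Lemma dsubst_hmul (u v : hull k p) :
  dsubst F (hmul u v).2 = u.1 *: dsubst F v.2 + v.1 *: dsubst F u.2 +
    dsubst F u.2 * delta (dsubst F v.2).
Proof.
rewrite -[X in _ = _ + _ * X](dsubst_delta F v.2).
by rewrite -[X in _ = _ + X](dsubstM F u.2) -!dsubstZ -!dsubstD.
Qed.

Lemma bounded_hmul s s' d1 d2 (a b : k) (g h : dpoly k n) :
  (s' < s)%N -> bounded s d1 g -> bounded s' d2 h ->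
  bounded s (d1 + d2) (a *: h + b *: g + g * delta h).
Proof.
move=> ss bg bh; apply: boundedD.
  apply: boundedD; apply: boundedZ.
    exact: boundedW (ltnW ss) (leq_addl _ _) bh.
  exact: boundedW (leqnn s) (leq_addr _ _) bg.
exact: boundedM bg (boundedW ss (leqnn _) (bounded_delta bh)).
Qed.

(** The two components are the two senses of substituting f; a relation has
    to hold in both, and both grow at the same rate. *)
Definition bounded_expr s d (e : nexpr k p) : Prop :=
  bounded s d (neval f e).2 /\
  bounded s d (dsubst F (neval (@Nvar k p) e).2).

Lemma bounded_exprW s1 s2 d1 d2 e : (s1 <= s2)%N -> (d1 <= d2)%N ->
  bounded_expr s1 d1 e -> bounded_expr s2 d2 e.
Proof.
by move=> ss dd [b1 b2]; split; [apply: boundedW b1 | apply: boundedW b2].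
Qed.

(** The asymmetry of the order bounds drives the whole count: only the right
    factor is differentiated, so only its order grows. *)
Lemma bounded_exprM s s' d1 d2 e1 e2 : (s' < s)%N ->
  bounded_expr s d1 e1 -> bounded_expr s' d2 e2 ->
  bounded_expr s (d1 + d2) (EMul e1 e2).
Proof.
move=> ss [b1 b1'] [b2 b2']; split; first exact: bounded_hmul ss b1 b2.
by rewrite [X in bounded _ _ X]dsubst_hmul; apply: bounded_hmul ss b1' b2'.
Qed.

Lemma bounded_exprV s d i : bounded s d (f i).2 -> bounded_expr s d (EVar k i).
Proof.
move=> bf; split=> //=; rewrite dsubst_dvar /=.
by apply: boundedD; first exact: boundedC.
Qed.
End BoundedExpressions.

Section Products.
Variables (k : fieldType) (p : nat) (z : 'I_p).

Definition lmul_expr (i : 'I_p) r : nexpr k p :=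
  iter r (EMul (EVar k z)) (EVar k i).

Definition rmul_expr (e : nexpr k p) (l : seq (jet p)) : nexpr k p :=
  foldl (fun e' v => EMul e' (lmul_expr v.1 v.2)) e l.

Lemma hmul_N0 (g h : dpoly k p) : hmul (0, g) (0, h) = (0, circ g h).
Proof. by rewrite /hmul /= mulr0 !scale0r !add0r. Qed.

Lemma neval_lmul_expr i r :
  neval (@Nvar k p) (lmul_expr i r) = (0, lmul_iter k z i r).
Proof. by elim: r => //= r ->; rewrite hmul_N0. Qed.

Lemma neval_rmul_expr e (g : dpoly k p) l :
  neval (@Nvar k p) e = (0, g) ->
  neval (@Nvar k p) (rmul_expr e l) =
  (0, g * \prod_(v <- l) delta (lmul_iter k z v.1 v.2)).
Proof.
elim: l e g => [|v l IHl] e g eg; first by rewrite big_nil mulr1.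
rewrite /= (IHl _ (circ g (lmul_iter k z v.1 v.2))).
  by rewrite big_cons mulrA.
by rewrite /= eg neval_lmul_expr hmul_N0.
Qed.

Lemma bounded_lmul_expr n (f : 'I_p -> hull k n) s d i r :
  (forall j, bounded s d (f j).2) ->
  bounded_expr f (s + r) (d * r.+1) (lmul_expr i r).
Proof.
move=> bf; elim: r => [|r IHr].
  by rewrite addn0 muln1; apply: bounded_exprV.
rewrite mulnS; apply: bounded_exprM IHr; first by rewrite addnS.
exact: bounded_exprW (leq_addr _ _) (leqnn d) (bounded_exprV (bf z)).
Qed.

(** The number of factors enters the degree only: the accumulated product,
    being always the left factor, is never differentiated. *)
Lemma bounded_rmul_expr n (f : 'I_p -> hull k n) s d d' R e l :
  (forall j, bounded s d (f j).2) -> bounded_expr f (s + R) d' e ->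
  (forall v, v \in l -> (v.2 < R)%N) ->
  bounded_expr f (s + R) (d' + d * R * size l) (rmul_expr e l).
Proof.
move=> bf; elim: l e d' => [|v l IHl] e d' be lR; first by rewrite muln0 addn0.
rewrite mulnS addnA; apply: IHl => [|w wl]; last first.
  by apply: lR; rewrite in_cons wl orbT.
have vR : (v.2 < R)%N by apply: lR; rewrite mem_head.
apply: (@bounded_exprM _ _ _ _ _ (s + v.2)) be _; first by rewrite ltn_add2l.
apply: bounded_exprW (leqnn _) _ (bounded_lmul_expr _ _ bf).
by rewrite leq_mul2l vR orbT.
Qed.
End Products.

(** * Linear combinations of expressions *)

Section LinearCombinations.
Variables (k : fieldType) (p : nat) (T : Type).

Definition comb_expr (r : seq T) (c : T -> k) (E : T -> nexpr k p) :=
  foldr (fun t e => EAdd (EMul (EConst p (c t)) (E t)) e) (EConst p 0) r.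

Lemma neval_comb_expr n (f : 'I_p -> hull k n) r c E :
  neval f (comb_expr r c E) =
  (\sum_(t <- r) c t * (neval f (E t)).1,
   \sum_(t <- r) c t *: (neval f (E t)).2).
Proof.
elim: r => [|t r IHr] /=; first by rewrite !big_nil.
rewrite IHr !big_cons /hmul /= scaler0 addr0.
by rewrite /circ mul0r addr0.
Qed.
End LinearCombinations.

Lemma mcoeff_comb (k : fieldType) p (T : Type) (r : seq T) (c : T -> k)
    (G : T -> dpoly k p) m :
  (\sum_(t <- r) c t *: G t)@_m = \sum_(t <- r) c t * (G t)@_m.
Proof.
elim: r => [|t r IHr]; first by rewrite !big_nil mcoeff0.
by rewrite !big_cons mcoeffD mcoeffZ IHr.
Qed.

Lemma linear_comb (k : fieldType) (V W : lmodType k) (h : V -> W)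
    (T : Type) (r : seq T) (c : T -> k) (G : T -> V) :
  h 0 = 0 -> (forall u v, h (u + v) = h u + h v) ->
  (forall a u, h (a *: u) = a *: h u) ->
  h (\sum_(t <- r) c t *: G t) = \sum_(t <- r) c t *: h (G t).
Proof.
move=> h0 hD hZ; elim: r => [|t r IHr]; first by rewrite !big_nil.
by rewrite !big_cons hD hZ IHr.
Qed.

Lemma in_N_neval_Nvar (k : fieldType) p (e : nexpr k p) :
  in_N (neval (@Nvar k p) e).
Proof.
elim: e => [i|c|a IHa b IHb|a IHa b IHb]; rewrite /in_N /=.
- exact: N0_var.
- exact: N0_zero.
- exact: N0_add.
- by apply: N0_add; [apply: N0_add; apply: N0_scale | apply: N0_circ].
Qed.

(** * The products and their number *)

Section JetLists.
Variables (p R d : nat) (t : {ffun 'I_p * 'I_R -> 'I_d.+1}).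

Definition jet_list : seq (jet p) :=
  flatten [seq nseq (t v) (v.1, nat_of_ord v.2) | v : 'I_p * 'I_R].

Lemma jet_list_lt v : v \in jet_list -> (v.2 < R)%N.
Proof. by case/flatten_mapP => w _ /nseqP[-> _] /=. Qed.

Lemma size_jet_list : (size jet_list <= p * R * d)%N.
Proof.
rewrite size_flatten /shape -map_comp sumnE big_map.
apply: (@leq_trans (\sum_(v <- enum {: 'I_p * 'I_R}) d)%N).
  by apply: leq_sum => v _; rewrite /= size_nseq -ltnS.
rewrite big_const_seq count_predT iter_addn_0 -cardE.
by rewrite card_prod !card_ord mulnC.
Qed.

Lemma prod_jet_list (A : comNzRingType) (G : jet p -> A) :
  \prod_(v <- jet_list) G v =
  \prod_(v : 'I_p * 'I_R) G (v.1, nat_of_ord v.2) ^+ t v.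
Proof.
rewrite big_flatten big_map big_enum /=; apply: eq_bigr => v _.
by rewrite big_nseq iter_mulr_1.
Qed.
End JetLists.

(** The homomorphism of lmul_iter_independent sends the products to pairwise
    distinct monomials. *)
Lemma rmul_independent (k : fieldType) p (z : 'I_p) R d
    (c : {ffun 'I_p * 'I_R -> 'I_d.+1} -> k) :
  \sum_t c t *: (dvar k z 0 *
    \prod_(v <- jet_list t) delta (lmul_iter k z v.1 v.2)) = 0 ->
  forall t, c t = 0.
Proof.
have [x x1 xR] := lmul_iter_independent k z R.
have xE (t : {ffun 'I_p * 'I_R -> 'I_d.+1}) :
    jet_eval x (dvar k z 0 * \prod_(v <- jet_list t)
      delta (lmul_iter k z v.1 v.2)) = << jet_mon t >>.
  apply: (etrans (jet_evalM x _ _)); rewrite jet_eval_dvar x1 mul1r.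
  rewrite (big_morph (jet_eval x) (jet_evalM x) (jet_eval1 x)).
  rewrite (eq_big_seq (fun v => dvar k v.1 v.2)) => [|v /jet_list_lt vR].
    by rewrite prod_jet_list jet_mon_prod.
  exact: xR.
move=> c0 t.
have : \sum_t c t *: << jet_mon t >> = 0 :> dpoly k p.
  rewrite -(eq_bigr _ (fun t _ => congr1 ( *:%R (c t)) (xE t))).
  rewrite -(linear_comb _ _ _ (@mmap0 _ _ _ _ _) (jet_evalD x) (jet_evalZ x)) c0.
  exact: mmap0.
move/(congr1 (mcoeff (jet_mon t))); rewrite mcoeff_comb mcoeff0.
rewrite (eq_bigr (fun u => c u * (u == t)%:R)) => [|u _]; last first.
  by rewrite mcoeffU1 (inj_eq (@jet_mon_inj _ _ _)).
rewrite (bigD1 t) //= eqxx mulr1 big1 ?addr0 // => u ut.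
by rewrite (negbTE ut) mulr0.
Qed.

(** The left side is the number of linear conditions on the coefficients of a
    relation: one for the scalar part, and twice the number of exponent vectors on n (S + R + 1)
    variables, with exponents up to the degree bound of the products. *)
Lemma counting n S D : exists R d,
  (1 + 2 * (D + D * R * (n.+1 * R * d)).+1 ^ (n * (S + R).+1)
     < d.+1 ^ (n.+1 * R))%N.
Proof.
(* The least R for which the exponent on the right exceeds that on the left. *)
pose R := (n * S.+1).+1; pose M := (n * (S + R).+1)%N.
have NE : (n.+1 * R = M.+1)%N by rewrite /M /R; lia.
pose C := (D * (1 + R * (n.+1 * R))).+1.
(* The degree bound plus one is at most C (d + 1), so the left side is at most
   3 C^M (d + 1)^M. *)
exists R, (3 * C ^ M)%N; rewrite -/M NE.
set d := (3 * C ^ M)%N.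
have le1 : ((D + D * R * (M.+1 * d)).+1 <= C * d.+1)%N by rewrite /C NE; nia.
case: (posnP M) => [->|M0].
  by rewrite !expn0 expn1 /d; have := expn_gt0 C M; lia.
have le2 : ((D + D * R * (M.+1 * d)).+1 ^ M <= C ^ M * d.+1 ^ M)%N.
  by rewrite -expnMn leq_exp2r.
have dM : (0 < d.+1 ^ M)%N by rewrite expn_gt0.
have CM : (0 < C ^ M)%N by rewrite expn_gt0.
rewrite expnS {2}/d; nia.
Qed.

(** * Dependence *)

Theorem corollary3 (k : fieldType) (hk : [pchar k] =i pred0) (n : nat)
    (f : 'I_n.+1 -> hull k n) (hf : forall i : 'I_n.+1, in_N (f i)) :
  novikov_dependent f.
Proof.
pose F i := dval (f i).
have [S [D bf]] := bounded_family_ex (fun i => (f i).2).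
have [R [d lt_count]] := counting n S D.
set B := (D + _)%N in lt_count.
pose T := {ffun 'I_n.+1 * 'I_R -> 'I_d.+1}.
pose U := {ffun 'I_n * 'I_(S + R).+1 -> 'I_B.+1}.
pose e (t : T) := rmul_expr ord0 (EVar k ord0) (jet_list t).
have be t : bounded_expr f (S + R) B (e t).
  have b0 : bounded_expr f (S + R) D (EVar k ord0).
    exact: bounded_exprW (leq_addr _ _) (leqnn D) (bounded_exprV (bf ord0)).
  apply: bounded_exprW (leqnn _) _
    (bounded_rmul_expr ord0 bf b0 (@jet_list_lt _ _ _ t)).
  by rewrite leq_add2l leq_mul2l size_jet_list orbT.
have eE t : neval (@Nvar k n.+1) (e t) = (0, dvar k ord0 0 *
    \prod_(v <- jet_list t) delta (lmul_iter k ord0 v.1 v.2)).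
  exact: neval_rmul_expr.
(* The coordinates of both values of e t.  Only the first has a scalar
   coordinate, since e t takes a value in N_0 at the generators. *)
pose A (t : T) (j : option (U + U)) := match j with
  | None => (neval f (e t)).1
  | Some (inl u) => (neval f (e t)).2@_(jet_mon u)
  | Some (inr u) => (dsubst F (neval (@Nvar k n.+1) (e t)).2)@_(jet_mon u)
  end.
have lt_card : (#|{: option (U + U)}| < #|T|)%N.
  rewrite card_option card_sum !card_ffun !card_prod !card_ord.
  by move: lt_count; rewrite addnn -mul2n add1n.
have [c [t0 ct0] cA] := linear_relation A lt_card.
pose E := comb_expr (enum T) c e.
exists (neval (@Nvar k n.+1) E); split; first exact: in_N_neval_Nvar.
  apply: contraNneq ct0 => E0; apply/eqP.
  apply: (@rmul_independent k n.+1 ord0 R d c).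
  have := congr1 snd E0; rewrite neval_comb_expr /= big_enum /= => E2.
  by rewrite -[RHS]E2; apply: eq_bigr => t _; rewrite eE.
have sum_bounded (G : T -> dpoly k n) : (forall t, bounded (S + R) B (G t)) ->
    (forall u : U, \sum_t c t * (G t)@_(jet_mon u) = 0) ->
    \sum_(t <- enum T) c t *: G t = 0.
  move=> bG G0; apply: (@bounded_eq0 k n (S + R) B).
    by apply: bounded_sum => t _; apply: boundedZ.
  by move=> u; rewrite mcoeff_comb big_enum; apply: G0.
split.
  exists E; split=> //; rewrite neval_comb_expr; apply: (congr2 pair).
    by rewrite big_enum; apply: (cA None).
  apply: sum_bounded => [t|u]; first by case: (be t).
  exact: (cA (Some (inl u))).
have -> : dval (neval (@Nvar k n.+1) E) =
    \sum_(t <- enum T) c t *: (neval (@Nvar k n.+1) (e t)).2.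
  rewrite /dval neval_comb_expr /= [X in X%:MP]big1 ?malgC0E ?add0r //.
  by move=> t _; rewrite eE mulr0.
have F0 : dsubst F 0 = 0 by exact: mmap0.
apply: (etrans (linear_comb _ _ _ F0 (dsubstD F) (dsubstZ F))).
apply: sum_bounded => [t|u]; first by case: (be t).
exact: (cA (Some (inr u))).
Qed.
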